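(* Let $n\ge 3$ and let $\mathcal{T}_n$ be a uniformly random triangulation of a convex $n$-gon $P_n$ with vertices $v_{n,1},\dots,v_{n,n}$ in cyclic order. Let $\mathcal{S}_n=\sum (j-l)$, where the sum is over all triangles of $\mathcal{T}_n$, a triangle being written with vertices $v_{n,l},v_{n,j},v_{n,r}$ where $l<j<r$. Then $$\mathbb{E}(\mathcal{S}_n)=\frac{2^{2n-5}-\binom{2n-5}{n-2}}{C_{n-2}}.$$
   Context: A triangulation of $P_n$ is a set of $n-3$ noncrossing diagonals partitioning $P_n$ into $n-2$ triangles; there are $C_{n-2}$ of them, where $C_k=\frac{1}{k+1}\binom{2k}{k}$, and $\mathcal{T}_n$ is chosen uniformly among them. In a triangle with vertices $v_{n,l},v_{n,j},v_{n,r}$, $l<j<r$, the angle at $v_{n,r}$ is called blue; when $P_n$ is regular its size is proportional to $j-l$, so $\mathcal{S}_n$ is the total of the blue angles up to a constant factor. *)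

(* Defs.v *)
From mathcomp Require Import all_boot all_order all_algebra.

Set Implicit Arguments.
Unset Strict Implicit.
Unset Printing Implicit Defensive.

Import GRing.Theory Num.Theory.
Local Open Scope ring_scope.

(* The vertices of the convex n-gon, in cyclic order, are 'I_n, so that vertex
   number k + 1 is k : 'I_n; only differences of labels are used below.
   A chord joining two vertices is the pair of its endpoints, smaller first. *)
Definition chord (n : nat) : finType := ('I_n * 'I_n)%type.

Definition is_side (n : nat) (c : chord n) : bool :=
  ((c.1.+1 == c.2 :> nat) || (c.1 == 0 :> nat) && (c.2.+1 == n :> nat))%N.

Definition is_diagonal (n : nat) (c : chord n) : bool :=
  (c.1 < c.2)%N && ~~ is_side c.

(* The polygon being convex, two chords meet at an interior point of both if
   and only if their endpoints strictly alternate around the polygon. *)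
Definition crossing (n : nat) (c d : chord n) : bool :=
  [&& c.1 < d.1, d.1 < c.2 & c.2 < d.2]%N
  || [&& d.1 < c.1, c.1 < d.2 & d.2 < c.2]%N.

Definition noncrossing (n : nat) (D : {set chord n}) : bool :=
  [forall c in D, forall d in D, ~~ crossing c d].

(* The triangles ((l, j), r), with l < j < r, whose three sides are sides of
   the polygon or belong to D.  For noncrossing D, no chord of D enters such a
   triangle, so these are exactly the triangular cells cut out by D. *)
Definition triangles (n : nat) (D : {set chord n}) :
    {set 'I_n * 'I_n * 'I_n} :=
  let edge c := is_side c || (c \in D) in
  [set t : 'I_n * 'I_n * 'I_n | let: (l, j, r) := t in
     [&& l < j, j < r, edge (l, j), edge (j, r) & edge (l, r)]%N].

(* The n - 3 noncrossing diagonals cut the polygon into n - 2 cells; the last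
   clause says that all of these cells are triangles. *)
Definition is_triangulation (n : nat) (D : {set chord n}) : bool :=
  [&& [forall c in D, is_diagonal c], noncrossing D,
      #|D| == (n - 3)%N & #|triangles D| == (n - 2)%N].

Definition triangulations (n : nat) : {set {set chord n}} :=
  [set D | is_triangulation D].

Definition blue_sum (n : nat) (D : {set chord n}) : nat :=
  (\sum_(t in triangles D) (let: (l, j, r) := t in j - l))%N.

(* Expectation of f(x) for x uniformly distributed on the nonempty set A. *)
Definition uniform_expectation (R : realFieldType) (T : finType) (A : {set T})
    (f : T -> R) : R :=
  \sum_(x in A) #|A|%:R^-1 * f x.

Definition catalan (R : realFieldType) (k : nat) : R :=
  k.+1%:R^-1 * 'C(2 * k, k)%:R.

(* Main.v *)
(* Adding the sides of the polygon to a triangulation gives a set E of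
   noncrossing chords of [0, n - 1] in which every edge (i, k) with i + 1 < k
   has an apex j, i < j < k, with (i, j) and (j, k) in E.  Such a set splits at
   the apex of its longest edge (a, b) into two smaller ones, so the number C of
   these sets and the sum S of their blue sums satisfy, for length m + 2,
     C_(m+1) = sum_i C_i C_(m-i),
     S_(m+1) = sum_i ((i + 1) C_i C_(m-i) + S_i C_(m-i) + C_i S_(m-i)).
   With B_k = 'C(2k, k), the solutions are C_k = B_k / (k + 1) and
   S_k = (4^k - B_k) / 2; both verifications rest on the symmetry i <-> m - i of
   the sums and on (k + 2) C_(k+1) = (4k + 2) C_k. *)
Require Import Defs.
From mathcomp Require Import all_boot all_order all_algebra.
From mathcomp Require Import zify ring lra.

Set Implicit Arguments.
Unset Strict Implicit.
Unset Printing Implicit Defensive.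

Import GRing.Theory Num.Theory.

(** * Triangulated intervals and their splitting at the apex *)

Section Intervals.
Variable n : nat.
Implicit Types (a b i j k l r : 'I_n) (c d : chord n) (E : {set chord n}).

Definition apex_of E i k j : bool :=
  [&& i < j, j < k, (i, j) \in E & (j, k) \in E].

(* E contains the sides of the polygon on [a, b] as well as its diagonals. *)
Definition triangulates a b E : bool :=
  [&& (a, b) \in E, [forall c in E, [&& a <= c.1, c.1 < c.2 & c.2 <= b]],
      noncrossing E
    & [forall c in E, (c.1.+1 < c.2) ==> [exists j, apex_of E c.1 c.2 j]]].

Lemma noncrossingP E :
  reflect (forall i k l r, (i, k) \in E -> (l, r) \in E ->
             ~ (i < l /\ l < k /\ k < r)) (noncrossing E).
Proof.
apply: (iffP forall_inP) => [ncE i k l r cE dE [? [? ?]]|ncE [i k] cE].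
  have /forall_inP/(_ _ dE) := ncE _ cE.
  by rewrite /crossing /=; lia.
apply/forall_inP => [[l r] dE]; rewrite /crossing /=.
have := ncE _ _ _ _ cE dE; have := ncE _ _ _ _ dE cE.
lia.
Qed.

Lemma triangulatesP a b E :
  reflect [/\ (a, b) \in E,
              forall i k, (i, k) \in E -> [/\ a <= i, i < k & k <= b],
              noncrossing E
            & forall i k, (i, k) \in E -> i.+1 < k -> exists j, apex_of E i k j]
          (triangulates a b E).
Proof.
apply: (iffP and4P) => [[abE /forall_inP inE ncE /forall_inP apE]|].
  split=> // i k ikE; first by apply/and3P; apply: inE ikE.
  by move=> lt_ik; apply/existsP; apply: (implyP (apE _ ikE)).
case=> abE inE ncE apE; split=> //; apply/forall_inP => [[i k] ikE] /=.
  by apply/and3P; apply: inE.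
by apply/implyP => lt_ik; apply/existsP; apply: apE.
Qed.

(** If [j < j'] were both apexes, the edges [(i, j')] and [(j, k)] would cross. *)
Lemma apex_of_uniq E i k j j' :
  noncrossing E -> apex_of E i k j -> apex_of E i k j' -> j = j'.
Proof.
move=> /noncrossingP ncE /and4P[? ? ijE jkE] /and4P[? ? ij'E j'kE].
have ? := ncE _ _ _ _ ijE j'kE; have ? := ncE _ _ _ _ ij'E jkE.
by apply: val_inj => /=; lia.
Qed.

Definition join a b E1 E2 : {set chord n} := (a, b) |: (E1 :|: E2).

Definition restrict a b E : {set chord n} :=
  [set c in E | (a <= c.1) && (c.2 <= b)].

Lemma in_join a b E1 E2 c :
  (c \in join a b E1 E2) = [|| c == (a, b), c \in E1 | c \in E2].
Proof. by rewrite !inE. Qed.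

Lemma in_restrict a b E c :
  (c \in restrict a b E) = [&& c \in E, a <= c.1 & c.2 <= b].
Proof. by rewrite inE. Qed.

(** The default [a] is never itself an apex; [apex_ofP] covers the intervals where an apex
    exists. *)
Definition apex E a b : 'I_n := odflt a [pick j | apex_of E a b j].

(** Edges of [E1] and of [E2] live on intervals sharing only [j], and [(a, b)] surrounds them all,
    so new crossings cannot arise; the new edge has apex [j]. *)
Lemma join_triangulates a b j E1 E2 :
    a < j -> j < b -> triangulates a j E1 -> triangulates j b E2 ->
  triangulates a b (join a b E1 E2).
Proof.
move=> aj jb /triangulatesP[ajE1 in1 /noncrossingP nc1 ap1].
move=> /triangulatesP[jbE2 in2 /noncrossingP nc2 ap2].
apply/triangulatesP; split.
- by rewrite !inE eqxx.
- move=> i k; rewrite !inE => /or3P[/eqP[-> ->]|/in1[? ? ?]|/in2[? ? ?]]; split; lia.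
- apply/noncrossingP => i k l r.
  rewrite !inE => /or3P[/eqP[-> ->]|ik|ik] /or3P[/eqP[-> ->]|lr|lr];
    try (have := in1 _ _ ik; case=> ? ? ?); try (have := in2 _ _ ik; case=> ? ? ?);
    try (have := in1 _ _ lr; case=> ? ? ?); try (have := in2 _ _ lr; case=> ? ? ?);
    try lia; by [apply: nc1|apply: nc2].
- move=> i k; rewrite !inE => /or3P[/eqP[-> ->]|ik|ik] lt_ik.
  + by exists j; apply/and4P; rewrite !inE ajE1 jbE2 !orbT.
  + have [j' /and4P[? ? ij kj]] := ap1 _ _ ik lt_ik.
    by exists j'; apply/and4P; rewrite !inE ij kj !orbT.
  + have [j' /and4P[? ? ij kj]] := ap2 _ _ ik lt_ik.
    by exists j'; apply/and4P; rewrite !inE ij kj !orbT.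
Qed.

Lemma apex_of_join a b j E1 E2 :
    a < j -> j < b -> triangulates a j E1 -> triangulates j b E2 ->
  apex_of (join a b E1 E2) a b j.
Proof.
move=> aj jb /triangulatesP[ajE1 _ _ _] /triangulatesP[jbE2 _ _ _].
by apply/and4P; rewrite !inE ajE1 jbE2 !orbT.
Qed.

Lemma apexE E a b j : noncrossing E -> apex_of E a b j -> apex E a b = j.
Proof.
rewrite /apex => ncE apj; case: pickP => [j' apj'|/(_ j)] /=.
  exact: apex_of_uniq apj' apj.
by rewrite apj.
Qed.

(** Neither [(a, b)] nor an edge of [E2] fits into [[a, j]], as each ends beyond [j]. *)
Lemma restrict_joinl a b j E1 E2 :
    a < j -> j < b -> triangulates a j E1 -> triangulates j b E2 ->
  restrict a j (join a b E1 E2) = E1.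
Proof.
move=> aj jb /triangulatesP[ajE1 in1 _ _] /triangulatesP[jbE2 in2 _ _].
apply/setP => [[i k]]; rewrite !inE /=.
apply/idP/idP => [/andP[/or3P[/eqP[-> ->]|//|/in2[]]]|ik]; try lia.
by have [] := in1 _ _ ik; rewrite ik orbT /=; lia.
Qed.

Lemma restrict_joinr a b j E1 E2 :
    a < j -> j < b -> triangulates a j E1 -> triangulates j b E2 ->
  restrict j b (join a b E1 E2) = E2.
Proof.
move=> aj jb /triangulatesP[ajE1 in1 _ _] /triangulatesP[jbE2 in2 _ _].
apply/setP => [[i k]]; rewrite !inE /=.
apply/idP/idP => [/andP[/or3P[/eqP[-> ->]|/in1[]|//]]|ik]; try lia.
by have [] := in2 _ _ ik; rewrite ik !orbT /=; lia.
Qed.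

Lemma restrict_triangulates a b i k E :
  triangulates a b E -> (i, k) \in E -> triangulates i k (restrict i k E).
Proof.
move=> /triangulatesP[_ inE' /noncrossingP ncE apE] ikE.
apply/triangulatesP; split.
- by rewrite inE ikE /= !leqnn.
- by move=> l r; rewrite inE /= => /and3P[/inE'[? ? ?] ? ?]; split.
- apply/noncrossingP => l r l' r'; rewrite !inE => /andP[lr _] /andP[lr' _].
  exact: ncE.
- move=> l r; rewrite inE => /and3P[/= lr ? ?] lt_lr.
  have [j /and4P[? ? lj jr]] := apE _ _ lr lt_lr.
  by exists j; apply/and4P; rewrite !inE /= lj jr; split=> //=; lia.
Qed.

Lemma apex_ofP a b E :
  triangulates a b E -> a.+1 < b -> apex_of E a b (apex E a b).
Proof.
move=> /triangulatesP[abE _ ncE apE] ab.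
by have [j apj] := apE _ _ abE ab; rewrite (apexE ncE apj).
Qed.

(** An edge passing over [j] crosses [(a, j)] unless it starts at [a], and crosses [(j, b)] unless
    it ends at [b]. Hence only [(a, b)] passes over [j]. *)
Lemma join_restrict a b j E : triangulates a b E -> apex_of E a b j ->
  join a b (restrict a j E) (restrict j b E) = E.
Proof.
move=> /triangulatesP[abE inE' /noncrossingP ncE _] /and4P[aj jb ajE jbE].
apply/setP => [[i k]]; rewrite !inE /=.
apply/idP/idP => [+|ikE].
  by case/or3P => [/eqP[-> ->]|/andP[]|/andP[]].
have [ai ik kb] := inE' _ _ ikE; rewrite ikE /= ai kb /= andbT.
have ? := ncE _ _ _ _ ajE ikE; have ? := ncE _ _ _ _ ikE jbE.
rewrite -pair_eqE /= -!val_eqE /=; lia.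
Qed.

Lemma triangulates_base a b E : a.+1 = b ->
  triangulates a b E = (E == [set (a, b)]).
Proof.
move=> ab; apply/idP/eqP => [/triangulatesP[abE inE' _ _]|->].
  apply/setP => [[i k]]; rewrite !inE; apply/idP/eqP => [/inE'[? ? ?]|[-> ->] //].
  by congr (_, _); apply: val_inj => /=; lia.
apply/triangulatesP; split; rewrite ?inE //.
- by move=> i k; rewrite !inE => /eqP[-> ->]; split; lia.
- by apply/noncrossingP => i k l r; rewrite !inE => /eqP[-> ->] /eqP[-> ->]; lia.
- by move=> i k; rewrite !inE => /eqP[-> ->]; lia.
Qed.

Lemma triangulates_ind (P : 'I_n -> 'I_n -> {set chord n} -> Prop) :
    (forall a b, a.+1 = b -> P a b [set (a, b)]) ->
    (forall a b j E1 E2, a < j -> j < b ->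
       triangulates a j E1 -> triangulates j b E2 ->
       P a j E1 -> P j b E2 -> P a b (join a b E1 E2)) ->
  forall a b E, triangulates a b E -> P a b E.
Proof.
move=> Pbase Pjoin a b; have [m] := ubnP (b - a).
elim: m a b => // m IHm a b lt_m E trE.
have /triangulatesP[abE inE' _ _] := trE.
have [_ ab _] := inE' _ _ abE.
have [ab1|ab1] := eqVneq a.+1 (b : nat).
  by move: trE; rewrite triangulates_base // => /eqP->; apply: Pbase.
have lt_ab : a.+1 < b by rewrite ltn_neqAle ab1.
have := apex_ofP trE lt_ab; move: (apex E a b) => j apj.
have /and4P[aj jb ajE jbE] := apj.
rewrite -(join_restrict trE apj); have tr1 := restrict_triangulates trE ajE.
have tr2 := restrict_triangulates trE jbE.
by apply: (Pjoin _ _ _ _ _ aj jb tr1 tr2); apply: IHm => //; lia.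
Qed.

Lemma side_triangulates a b E i k : triangulates a b E ->
  a <= i -> i.+1 = k -> k <= b -> (i, k) \in E.
Proof.
move=> trE ai ik kb; move: ai kb; move: a b E trE.
apply: triangulates_ind => [a b ab|a b j E1 E2 aj jb _ _ IH1 IH2] ai kb.
  rewrite inE; apply/eqP; congr (_, _); apply: val_inj => /=; lia.
rewrite !inE; have [kj|jk] := leqP k j; first by rewrite IH1 ?orbT.
by rewrite IH2 ?orbT //; lia.
Qed.

(** * Triangles of an edge set that already contains the sides *)

Definition triset E : {set 'I_n * 'I_n * 'I_n} :=
  [set t : 'I_n * 'I_n * 'I_n | let: (l, j, r) := t in
     (apex_of E l r j) && ((l, r) \in E)].

Lemma in_triset E l j r :
  ((l, j, r) \in triset E) = apex_of E l r j && ((l, r) \in E).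
Proof. by rewrite inE. Qed.

Lemma triset_base a b : triset [set (a, b)] = set0.
Proof.
apply/setP => [[[l j] r]]; rewrite !inE /apex_of !inE.
apply/negP => /andP[/and4P[lj _ /eqP[la _] /eqP[ja _]] _].
by rewrite la ja ltnn in lj.
Qed.

(** A triangle is located by its outer edge: under [(a, b)] only the apex [j] is possible, and any
    other outer edge puts the whole triangle in one of the two pieces. This serves both the number
    of triangles and the blue sum. *)
Lemma big_triset_join (R : Type) (idx : R) (op : Monoid.com_law idx)
    (F : 'I_n * 'I_n * 'I_n -> R) a b j E1 E2 :
    a < j -> j < b -> triangulates a j E1 -> triangulates j b E2 ->
  \big[op/idx]_(t in triset (join a b E1 E2)) F t =
  op (F (a, j, b))
     (op (\big[op/idx]_(t in triset E1) F t) (\big[op/idx]_(t in triset E2) F t)).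
Proof.
move=> aj jb tr1 tr2; have apj := apex_of_join aj jb tr1 tr2.
have trE := join_triangulates aj jb tr1 tr2.
have /triangulatesP[abE inE' ncE _] := trE.
have /triangulatesP[_ in1 _ _] := tr1; have /triangulatesP[_ in2 _ _] := tr2.
have -> : triset (join a b E1 E2) = (a, j, b) |: (triset E1 :|: triset E2).
  apply/setP => [[[l m] r]]; rewrite in_setU1 in_setU !in_triset.
  apply/andP/or3P => [[apm lrE]|].
  - have /and4P[? ? lmE mrE] := apm.
    move: lrE; rewrite in_join => /or3P[/eqP[el er]|lr|lr].
    + by subst l r; rewrite (apex_of_uniq ncE apm apj); constructor 1.
    + have [? ? ?] := in1 _ _ lr; constructor 2; rewrite lr andbT.
      rewrite -(restrict_joinl aj jb tr1 tr2); apply/and4P.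
      rewrite !in_restrict lmE mrE /=; split=> //=; lia.
    + have [? ? ?] := in2 _ _ lr; constructor 3; rewrite lr andbT.
      rewrite -(restrict_joinr aj jb tr1 tr2); apply/and4P.
      rewrite !in_restrict lmE mrE /=; split=> //=; lia.
  - case=> [/eqP[-> -> ->]//|/andP[/and4P[? ? lm mr] lr]|/andP[/and4P[? ? lm mr] lr]];
      by split; [apply/and4P|]; rewrite !in_join ?lm ?mr ?lr ?orbT.
rewrite big_setU1 /=; last first.
  rewrite in_setU !in_triset; apply/negP => /orP[]/andP[_].
    by move=> /in1[]; lia.
  by move=> /in2[]; lia.
congr (op _ _); rewrite -bigU /=; first by apply: eq_bigl => t; rewrite in_setU.
(* The outer edge of a common triangle would lie in both [[a, j]] and [[j, b]]. *)
rewrite -setI_eq0; apply/eqP/setP => [[[l m] r]].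
rewrite in_setI in_set0 !in_triset; apply/negP => /andP[/andP[_ /in1[? ? ?]]].
by move=> /andP[_ /in2[]]; lia.
Qed.

Lemma card_triset a b E : triangulates a b E -> #|triset E| = (b - a).-1.
Proof.
move: a b E; apply: triangulates_ind => [a b ab|a b j E1 E2 aj jb tr1 tr2].
  by rewrite triset_base cards0; lia.
by rewrite -!sum1_card (big_triset_join _ _ aj jb tr1 tr2) /= => -> ->; lia.
Qed.

Definition outer (t : 'I_n * 'I_n * 'I_n) : chord n := (t.1.1, t.2).

Definition long_edges E : {set chord n} := [set c in E | c.1.+1 < c.2].

Lemma outer_inj E : noncrossing E -> {in triset E &, injective outer}.
Proof.
move=> ncE [[l j] r] [[l' j'] r']; rewrite !inE /outer /=.
move=> /andP[apj _] /andP[apj' _] [el er]; subst l' r'.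
by rewrite (apex_of_uniq ncE apj apj').
Qed.

Lemma outer_triset_sub E : outer @: triset E \subset long_edges E.
Proof.
apply/subsetP => _ /imsetP[[[l j] r] + ->]; rewrite !inE /=.
by move=> /andP[/and4P[? ? _ _] ->] /=; lia.
Qed.

(* The cells below the long edges are triangles as soon as there are as many
   triangles as long edges, since a triangle is determined by its outer edge. *)
Lemma apex_ofP_card E : noncrossing E ->
  reflect (forall i k, (i, k) \in E -> i.+1 < k -> exists j, apex_of E i k j)
          (#|triset E| == #|long_edges E|).
Proof.
move=> ncE; rewrite -(card_in_imset (outer_inj ncE)).
have [_ ->] := subset_leqif_card (outer_triset_sub E).
apply: (iffP subsetP) => [sup i k ikE ik|apE [i k]].
  have /sup/imsetP[[[l j] r]] : (i, k) \in long_edges E by rewrite inE ikE.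
  by rewrite inE /outer /= => /andP[? _] [-> ->]; exists j.
rewrite inE /= => /andP[ikE /(apE _ _ ikE)[j apj]].
by apply/imsetP; exists (i, j, k); rewrite ?inE ?apj.
Qed.

(** Joining is a bijection whose inverse sends [E] to its apex and its two restrictions; this is the
    source of both recurrences. *)
Lemma sum_triangulates (R : Type) (idx : R) (op : Monoid.com_law idx)
    (F : {set chord n} -> R) a b : a.+1 < b ->
  \big[op/idx]_(E | triangulates a b E) F E =
  \big[op/idx]_(j : 'I_n | (a < j) && (j < b))
    \big[op/idx]_(E1 | triangulates a j E1)
      \big[op/idx]_(E2 | triangulates j b E2) F (join a b E1 E2).
Proof.
move=> ab.
under [RHS]eq_bigr => j _ do rewrite pair_big /=.
rewrite [RHS]pair_big_dep /=.
rewrite (reindex_onto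
  (fun p : 'I_n * ({set chord n} * {set chord n}) => join a b p.2.1 p.2.2)
  (fun E => let j := apex E a b in (j, (restrict a j E, restrict j b E)))) /=.
  apply: eq_bigl => [[j [E1 E2]]] /=.
  apply/idP/idP => [/andP[trE /eqP[ej e1 e2]]|].
    have := apex_ofP trE ab; rewrite ej in e1 e2 *; case/and4P => aj jb ajE jbE.
    have := restrict_triangulates trE ajE; have := restrict_triangulates trE jbE.
    by rewrite e1 e2 aj jb => -> ->.
  move=> /andP[/andP[aj jb] /andP[tr1 tr2]].
  have trE := join_triangulates aj jb tr1 tr2; rewrite trE /=.
  have apj := apex_of_join aj jb tr1 tr2; have /triangulatesP[_ _ ncE _] := trE.
  by rewrite (apexE ncE apj) (restrict_joinl aj) // (restrict_joinr aj).
by move=> E trE; apply: join_restrict => //; apply: apex_ofP.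
Qed.

End Intervals.

(** * From triangulations of the polygon to triangulated intervals *)

Section Polygon.
Variable m : nat.
Local Notation n := m.+3.
Implicit Types D E : {set chord n}.

Definition sides : {set chord n} := [set c | is_side c].

Lemma in_sides (i k : 'I_n) :
  ((i, k) \in sides) = (i.+1 == k :> nat) || (i == ord0) && (k == ord_max).
Proof. by rewrite inE /is_side /= eqSS -!val_eqE. Qed.

Lemma triangles_sides D : triangles D = triset (D :|: sides).
Proof.
apply/setP => [[[l j] r]]; rewrite !inE /apex_of !inE -!andbA.
by rewrite ![is_side _ || _]orbC.
Qed.

(** The endpoints of a side are neighbours around the polygon, so no chord can alternate with
    them. *)
Lemma noncrossing_sides D : (forall i k, (i, k) \in D -> i < k) ->
  noncrossing (D :|: sides) = noncrossing D.
Proof.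
move=> ltD; apply/noncrossingP/noncrossingP => ncD i k l r.
  by move=> ik lr; apply: ncD; rewrite inE ?ik ?lr.
have ? := ltn_ord k; have ? := ltn_ord r; rewrite !in_setU !in_sides.
rewrite -!val_eqE /= => /orP[ik|ik] /orP[lr|lr]; [exact: ncD|lia..].
Qed.

Lemma long_edges_sides D : (forall c, c \in D -> is_diagonal c) ->
  long_edges (D :|: sides) = (ord0, ord_max) |: D.
Proof.
move=> diagD; apply/setP => [[i k]]; rewrite in_setU1 inE in_setU in_sides /=.
apply/andP/orP => [[/orP[|/orP[|/andP[/eqP-> /eqP->]]]]|[/eqP[-> ->]|ikD]].
- by right.
- by move=> /eqP->; rewrite ltnn.
- by left.
- by rewrite !eqxx !orbT.
- rewrite ikD; split=> //; have := diagD _ ikD; rewrite /is_diagonal /is_side /=.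
  lia.
Qed.

(** The long edges are the diagonals and [(ord0, ord_max)]. In a triangulation they number n - 2,
    like the triangles, so each has an apex; conversely [card_triset] gives n - 2 triangles and
    hence n - 3 diagonals. The last conjunct, that [D] has no sides, has the form needed for
    reindexing by [D :|: sides]. *)
Lemma triangulationE D :
  is_triangulation D =
  triangulates ord0 ord_max (D :|: sides) && ((D :|: sides) :\: sides == D).
Proof.
have full : (ord0, ord_max) \in sides by rewrite in_sides !eqxx orbT.
have card_long : (forall c, c \in D -> is_diagonal c) ->
    #|long_edges (D :|: sides)| = #|D|.+1.
  move=> diagD; rewrite long_edges_sides // cardsU1.
  case: (boolP (_ \in D)) => // /diagD /andP[_] /negP[].
  by move: full; rewrite inE.
apply/and4P/andP => [[/forall_inP diagD ncD cardD cardT]|[trE /eqP eD]].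
  have ltD i k : (i, k) \in D -> i < k by move=> /diagD /andP[].
  have ncE : noncrossing (D :|: sides) by rewrite noncrossing_sides.
  split; last first.
    rewrite setDUl setDv setU0; apply/eqP/setDidPl.
    rewrite -setI_eq0; apply/eqP/setP => c; rewrite !inE; apply/negP => /andP[].
    by move=> /diagD /andP[_ /negP].
  apply/triangulatesP; split=> //.
  - by rewrite in_setU full orbT.
  - move=> i k; have := ltn_ord k; rewrite in_setU in_sides => ? ik.
    have ik' : i < k by move: ik => /orP[/ltD//|]; rewrite -!val_eqE /=; lia.
    by split=> //=; lia.
  - apply/apex_ofP_card => //.
    by rewrite card_long // -triangles_sides (eqP cardD) (eqP cardT) !subSS !subn0.
have /triangulatesP[_ inE' ncE apE] := trE.
have diagD c : c \in D -> is_diagonal c.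
  move=> cD; have : c \in (D :|: sides) :\: sides by rewrite eD.
  case: c cD => i k cD; rewrite in_setD => /andP[nside /inE'[_ ik _]].
  by rewrite /is_diagonal /= ik; move: nside; rewrite inE.
have cardT : #|triset (D :|: sides)| = m.+1 by rewrite (card_triset trE).
split.
- by apply/forall_inP.
- by rewrite -noncrossing_sides // => i k /diagD /andP[].
- move/(apex_ofP_card ncE)/eqP: apE; rewrite card_long // cardT => -[cardD].
  by rewrite -cardD !subSS subn0.
- by rewrite triangles_sides cardT !subSS subn0.
Qed.

Lemma sides_sub E : triangulates ord0 ord_max E -> sides \subset E.
Proof.
move=> trE; apply/subsetP => [[i k]].
rewrite in_sides => /orP[/eqP ik|/andP[/eqP-> /eqP->]].
  by apply: (side_triangulates trE) => //=; have := ltn_ord k.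
by have /triangulatesP[] := trE.
Qed.

Lemma big_triangulations (R : Type) (idx : R) (op : Monoid.com_law idx)
    (F : {set chord n} -> R) :
  \big[op/idx]_(D in triangulations n) F (D :|: sides) =
  \big[op/idx]_(E | triangulates ord0 ord_max E) F E.
Proof.
rewrite [RHS](reindex_onto (fun D => D :|: sides) (fun E => E :\: sides)) /=.
  by apply: eq_bigl => D; rewrite inE triangulationE.
move=> E trE; apply/setP => c; rewrite in_setU in_setD.
have /implyP := subsetP (sides_sub trE) c.
by case: (c \in sides) => /=; rewrite ?orbF.
Qed.

End Polygon.

Local Open Scope ring_scope.

(** * Identities for Catalan numbers and central binomials *)

Section Catalan.
Variable R : realFieldType.
Local Notation C := (catalan R).
Local Notation B k := ('C(2 * k, k)%:R : R).

Lemma central_binomialS k :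
  (k.+1 * 'C(2 * k.+1, k.+1) = 2 * (2 * k).+1 * 'C(2 * k, k))%N.
Proof.
have e1 : (k.+1 * 'C((2 * k).+2, k.+1) = (2 * k).+2 * 'C((2 * k).+1, k))%N.
  by rewrite -mul_bin_diag.
have e2 : (((2 * k).+1 - k) * 'C((2 * k).+1, k) = (2 * k).+1 * 'C(2 * k, k))%N.
  by rewrite -mul_bin_down.
have -> : (2 * k.+1 = (2 * k).+2)%N by lia.
have e3 : ((2 * k).+1 - k = k.+1)%N by lia.
rewrite e3 in e2; nia.
Qed.

Lemma catalanM k : k.+1%:R * C k = B k.
Proof. by rewrite /catalan mulrA divff ?mul1r // pnatr_eq0. Qed.

Lemma catalanS k : k.+2%:R * C k.+1 = (4 * k + 2)%:R * C k.
Proof.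
have k1 : k.+1%:R != 0 :> R by rewrite pnatr_eq0.
apply: (mulfI k1); rewrite catalanM mulrCA catalanM -!natrM.
by congr _%:R; rewrite central_binomialS; lia.
Qed.

Lemma catalan0 : C 0 = 1.
Proof. by rewrite /catalan muln0 bin0 invr1 mul1r. Qed.

(* Averaging with the reversed sum gives i + 1 the mean value (m + 2) / 2. *)
Lemma sum_weighted_sym (u : nat -> R) m :
  \sum_(i < m.+1) i.+1%:R * (u i * u (m - i)%N) =
  m.+2%:R / 2 * \sum_(i < m.+1) u i * u (m - i)%N.
Proof.
set W := \sum_(_ < _) _ * _.
have eW : W = \sum_(i < m.+1) (m - i).+1%:R * (u i * u (m - i)%N).
  rewrite /W (reindex_inj rev_ord_inj) /=; apply: eq_bigr => i _.
  by rewrite subSS subKn -1?ltnS // [u _ * u _]mulrC.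
suff : W + W = m.+2%:R * \sum_(i < m.+1) u i * u (m - i)%N.
  by rewrite mulrAC => <-; field.
rewrite {2}eW -big_split mulr_sumr /=; apply: eq_bigr => i _.
rewrite -mulrDl -natrD; congr (_%:R * _).
by have := ltn_ord i; lia.
Qed.

(** The sum of (i + 1) C_i C_(m+1-i) is evaluated twice: by symmetry it is (m + 3) / 2 times the
    wanted convolution; by [catalanS] and an index shift it reduces to the previous one. *)
Lemma catalan_convolution m : \sum_(i < m.+1) C i * C (m - i)%N = C m.+1.
Proof.
elim: m => [|m IHm].
  by rewrite big_ord1 subnn; have := catalanS 0; rewrite catalan0; lra.
have m3 : m.+3%:R != 0 :> R by rewrite pnatr_eq0.
have w := sum_weighted_sym C m.+1; have w' := sum_weighted_sym C m.
rewrite IHm in w'.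
have e : \sum_(i < m.+2) i.+1%:R * (C i * C (m.+1 - i)%N) =
         C m.+1 + \sum_(i < m.+1) (4 * i + 2)%:R * (C i * C (m - i)%N).
  rewrite big_ord_recl catalan0 subn0 !mul1r; congr (_ + _).
  apply: eq_bigr => i _; rewrite mulrA [X in X * _]catalanS.
  by rewrite subSS mulrA.
(* Here 4i + 2 = 4(i + 1) - 2 brings back the weight i + 1. *)
have e' : \sum_(i < m.+1) (4 * i + 2)%:R * (C i * C (m - i)%N) =
          4 * (m.+2%:R / 2 * C m.+1) - 2 * C m.+1.
  rewrite -w' -[in 2 * C _]IHm !mulr_sumr -sumrB; apply: eq_bigr => i _.
  by rewrite -[i.+1]addn1 !natrD; ring.
apply: (mulfI m3); rewrite catalanS.
transitivity (2 * (m.+3%:R / 2 * \sum_(i < m.+2) C i * C (m.+1 - i)%N)).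
  by field.
by rewrite -w e e'; field.
Qed.

(** Splitting off the last term gives x_(m+1) = 4 x_m + C_(m+1), which the closed form satisfies
    because 4 B_(m+1) - B_(m+2) = 2 C_(m+1). *)
Lemma catalan_pow4_convolution m :
  \sum_(i < m.+1) C i * 4 ^+ (m - i) = (4 ^+ m.+1 - B m.+1) / 2.
Proof.
elim: m => [|m IHm].
  by rewrite big_ord1 subnn catalan0 muln1 bin1; lra.
rewrite big_ord_recr /= subnn mulr1.
have -> : \sum_(i < m.+1) C i * 4 ^+ (m.+1 - i) =
          4 * \sum_(i < m.+1) C i * 4 ^+ (m - i).
  rewrite mulr_sumr; apply: eq_bigr => i _.
  by rewrite subSn -1?ltnS // exprS; ring.
rewrite {}IHm -!catalanM (catalanS m.+1) [4 ^+ m.+2]exprS.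
by field.
Qed.

(* The sum of the blue sums of all triangulations of a (k + 2)-gon. *)
Definition blue_total k : R := (4 ^+ k - B k) / 2.

(** By reversal the last two sums agree. Since B_k = (k + 1) C_k, their binomial parts together
    cancel the first sum, which leaves the convolution of C_i with 4^(m-i). *)
Lemma blue_totalS m :
  blue_total m.+1 = \sum_(i < m.+1)
    (i.+1%:R * (C i * C (m - i)%N) + blue_total i * C (m - i)%N
     + C i * blue_total (m - i)%N).
Proof.
rewrite !big_split /= sum_weighted_sym catalan_convolution.
have -> : \sum_(i < m.+1) blue_total i * C (m - i)%N =
          \sum_(i < m.+1) C i * blue_total (m - i)%N.
  rewrite (reindex_inj rev_ord_inj) /=; apply: eq_bigr => i _.
  by rewrite subSS subKn -1?ltnS // mulrC.
have -> : \sum_(i < m.+1) C i * blue_total (m - i)%N =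
   (\sum_(i < m.+1) C i * 4 ^+ (m - i)
    - \sum_(i < m.+1) i.+1%:R * (C i * C (m - i)%N)) / 2.
  have -> : \sum_(i < m.+1) i.+1%:R * (C i * C (m - i)%N) =
            \sum_(i < m.+1) C i * B (m - i)%N.
    rewrite (reindex_inj rev_ord_inj) /=; apply: eq_bigr => i _.
    by rewrite subSS subKn -1?ltnS // -catalanM; ring.
  rewrite -sumrB mulr_suml; apply: eq_bigr => i _.
  by rewrite /blue_total; field.
rewrite catalan_pow4_convolution sum_weighted_sym catalan_convolution.
by rewrite /blue_total; field.
Qed.

(** The central entry of an even row is the sum of two equal neighbours in the row above. For n = m
    + 3 this is the numerator of the theorem. *)
Lemma blue_total_binomial m :
  blue_total m.+1 = 2 ^+ (2 * m).+1 - 'C((2 * m).+1, m.+1)%:R.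
Proof.
rewrite /blue_total; have -> : B m.+1 = 2 * 'C((2 * m).+1, m.+1)%:R.
  rewrite -[2 : R]/(2%:R) -natrM; congr _%:R.
  have -> : (2 * m.+1 = (2 * m).+2)%N by lia.
  rewrite binS -[in X in (_ + X)%N]bin_sub; last by lia.
  have -> : ((2 * m).+1 - m = m.+1)%N by lia.
  lia.
rewrite [4 ^+ _]exprS [2 ^+ _]exprS exprM.
by have -> : 4 = 2 ^+ 2 :> R; [ring | field].
Qed.

End Catalan.

(** * Solving the recurrences for the count and the blue sum *)

Section Counting.
Variables (R : realFieldType) (n : nat).
Implicit Types (a b j : 'I_n) (E : {set chord n}).
Local Notation C := (catalan R).

Definition blue E : nat := (\sum_(t in triset E) (let: (l, j, r) := t in j - l))%N.

Lemma sum_between a b m (F : nat -> R) : (a + m.+2)%N = b ->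
  \sum_(j : 'I_n | (a < j < b)%N) F (j - a).-1 = \sum_(i < m.+1) F i.
Proof.
move=> eb; have bn := ltn_ord b.
(* The default [a] is never taken, as a + i + 1 < b < n. *)
pose h (i : 'I_m.+1) : 'I_n := insubd a (a + i.+1)%N.
have hE i : h i = (a + i.+1)%N :> nat.
  by rewrite val_insubd; have := ltn_ord i; case: ifP => //; lia.
rewrite (reindex_onto h (fun j => inord (j - a).-1)) /=; last first.
  by move=> j jab; apply: val_inj; rewrite /= hE inordK; lia.
apply: eq_big => [i|i _].
  have := ltn_ord i; rewrite hE => ?; apply/andP; split; first by lia.
  by apply/eqP/val_inj; rewrite /= inordK; lia.
by rewrite hE; congr F; lia.
Qed.

(** Meant for the blue sum of a join: [x] is the share of the top triangle, [f] and [g] those of the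
    two pieces, and the sums of 1 count triangulations. *)
Lemma sum_affine (I J : finType) (P : pred I) (Q : pred J) (x : R) f g :
  \sum_(i | P i) \sum_(j | Q j) (x + f i + g j) =
  x * ((\sum_(i | P i) 1) * (\sum_(j | Q j) 1))
  + (\sum_(i | P i) f i) * (\sum_(j | Q j) 1)
  + (\sum_(i | P i) 1) * (\sum_(j | Q j) g j).
Proof.
rewrite !big_distrlr mulr_sumr -!big_split /=; apply: eq_bigr => i _.
rewrite mulr_sumr -!big_split /=; apply: eq_bigr => j _; ring.
Qed.

(** Strong induction on [b - a]. The interval is a polygon with b - a + 1 vertices, whence the
    index. *)
Lemma sums_triangulates a b : (a < b)%N ->
  \sum_(E | triangulates a b E) 1 = C (b - a).-1 /\
  \sum_(E | triangulates a b E) (blue E)%:R = blue_total R (b - a).-1.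
Proof.
have [k] := ubnP (b - a)%N; elim: k a b => // k IHk a b lt_k ab.
have [ab1|ab1] := eqVneq a.+1 (b : nat).
  have -> : (b - a).-1 = 0%N by lia.
  have one : triangulates a b =1 pred1 [set (a, b)].
    by move=> E; rewrite triangulates_base.
  rewrite !(big_pred1 _ one) catalan0 /blue_total /blue triset_base big_set0.
  by rewrite muln0 bin0 subrr mul0r.
have [m eb] : exists m, (a + m.+2)%N = b by exists (b - a - 2)%N; lia.
have lt_ab : (a.+1 < b)%N by lia.
have -> : (b - a).-1 = m.+1 by lia.
have IH1 j : (a < j)%N && (j < b)%N -> _ := fun jab => IHk a j ltac:(lia) ltac:(lia).
have IH2 j : (a < j)%N && (j < b)%N -> _ := fun jab => IHk j b ltac:(lia) ltac:(lia).
have ebj j : (a < j)%N && (j < b)%N -> (b - j).-1 = (m - (j - a).-1)%N by lia.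
rewrite !sum_triangulates //; split.
  rewrite -catalan_convolution -(sum_between (fun i => C i * C (m - i)%N) eb).
  apply: eq_bigr => j jab; rewrite -(ebj j jab) -(IH1 j jab).1 -(IH2 j jab).1.
  by rewrite big_distrlr /=; under [RHS]eq_bigr do under eq_bigr do rewrite mulr1.
rewrite blue_totalS -(sum_between (fun i => i.+1%:R * (C i * C (m - i)%N)
  + blue_total R i * C (m - i)%N + C i * blue_total R (m - i)%N) eb).
apply: eq_bigr => j jab; rewrite -(ebj j jab) -(IH1 j jab).1 -(IH2 j jab).1.
rewrite -(IH1 j jab).2 -(IH2 j jab).2 -sum_affine.
have /andP[aj jb] := jab.
apply: eq_bigr => E1 tr1; apply: eq_bigr => E2 tr2.
(* The triangle [(a, j, b)] contributes j - a, which is i + 1 for i = j - a - 1. *)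
rewrite /blue (big_triset_join _ _ aj jb tr1 tr2) /= !natrD addrA.
by congr (_%:R + _ + _); lia.
Qed.

End Counting.

Theorem lemma7 (R : realFieldType) (n : nat) (hn : (3 <= n)%N) :
  uniform_expectation (triangulations n) (fun D => (blue_sum D)%:R : R)
  = (2 ^+ (2 * n - 5) - 'C(2 * n - 5, n - 2)%:R) / catalan R (n - 2).
Proof.
case: n hn => [|[|[|m]]] // _.
have lt0max : ((ord0 : 'I_m.+3) < (ord_max : 'I_m.+3))%N by [].
have [cardT sumT] := sums_triangulates R lt0max.
have -> : (2 * m.+3 - 5 = (2 * m).+1)%N by lia.
have -> : (m.+3 - 2 = m.+1)%N by lia.
(* Numerator and cardinality are both sums over triangulations of the interval from [ord0] to
   [ord_max], of index m + 1 = n - 2. *)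
rewrite /uniform_expectation -mulr_sumr mulrC -blue_total_binomial; congr (_ / _).
  rewrite -[RHS]sumT -big_triangulations; apply: eq_bigr => D _.
  by rewrite /blue_sum triangles_sides.
by rewrite -sum1_card natr_sum -[RHS]cardT -big_triangulations.
Qed.
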